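(* Let $n,s$ be integers with $s\geq 2$ and $s\leq \frac{n}{2^{17}\log n}$. Let $\mathcal{F}\subset \Sigma_n$ be a family of permutations such that $\nu(\mathcal{F})<s$. Then $|\mathcal{F}|\leq (s-1)(n-1)!$. Moreover, in the case of equality, $\mathcal{F}$ is of the form $\bigcup_{i=1}^{s-1}\Sigma_n[(x,y_i)]$ or $\bigcup_{i=1}^{s-1}\Sigma_n[(x_i,y)]$, where the $y_i$'s, respectively the $x_i$'s, are distinct elements of $[n]$ (and $x$, respectively $y$, is some element of $[n]$).
   Context: $\Sigma_n$ denotes the set of all permutations $[n]\to[n]$. A permutation $\sigma$ is identified with its graph $\{(i,\sigma(i)):i\in[n]\}\subset[n]^2$; two permutations intersect iff they agree at some point. $\nu(\mathcal{F})$ is the maximum number of pairwise disjoint (non-intersecting) permutations in $\mathcal{F}$. For a pair $(x,y)\in[n]^2$, $\Sigma_n[(x,y)]$ is the set of permutations $\pi\in\Sigma_n$ with $\pi(x)=y$. *)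

(* Defs.v *)
From Stdlib Require Import Reals.
From mathcomp Require Import all_boot all_order all_fingroup.
Set Implicit Arguments. Unset Strict Implicit. Unset Printing Implicit Defensive.

Definition perm_intersect (n : nat) (p q : {perm 'I_n}) : bool :=
  [exists i, p i == q i].

Definition pairwise_disjoint (n : nat) (G : {set {perm 'I_n}}) : bool :=
  [forall p in G, forall q in G, (p != q) ==> ~~ perm_intersect p q].

Definition nu (n : nat) (F : {set {perm 'I_n}}) : nat :=
  \max_(G : {set {perm 'I_n}} | (G \subset F) && pairwise_disjoint G) #|G|.

Definition Sig (n : nat) (x y : 'I_n) : {set {perm 'I_n}} :=
  [set p : {perm 'I_n} | p x == y].

Definition s_bound (n s : nat) : Prop :=
  Rle (INR s) (Rdiv (INR n) (Rmult (pow (INR 2) 17) (ln (INR n)))).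

(* Main.v *)
Require Import Defs.
From Stdlib Require Import Reals Lra.
From mathcomp Require Import all_boot all_order all_fingroup.
From mathcomp Require Import ssralg ssrint zify.

(** Call a set of [n] pairwise disjoint permutations a Latin square. The translates
    of a Latin square [L] cover every permutation equally often and each contains
    at most [s - 1] members of [F]; averaging gives the bound, and in the case of
    equality [F] meets every Latin square in exactly [s - 1] permutations.

    By Hall's theorem two disjoint permutations [p], [q] extend to a Latin square,
    and they may be traded there for any [p'], [q'] whose graphs have the same union;
    so the indicator [f] of [F] satisfies [f p + f q = f p' + f q']. It follows that
    the effect on [f] of exchanging the values of [p] at [a] and [b] depends only on
    [a], [b], [p a], [p b], and then that it is given by the alternating sum of a
    [2 x 2] minor of a matrix. Since [f] takes the values 0 and 1 only, two minors with
    nonzero alternating sum share a row or a column; hence all of them share a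
    common row or all share a common column, so membership of [p] in [F] is
    decided by one [p x], or by one [p^-1 y]. *)

Set Implicit Arguments. Unset Strict Implicit. Unset Printing Implicit Defensive.
Import GroupScope.
Delimit Scope R_scope with Re.

(** * Hall's marriage theorem *)

(** Induction on [#|S|]. If some nonempty proper subset [X] is tight, match [X] first and then
    [S :\: X] off the neighbours of [X]. Otherwise every such subset has a spare neighbour, so any
    [x] may take any [y] in [N x], and deleting [y] keeps Hall's condition for the rest. The point
    [u0] is only a default value for empty [S]. *)
Lemma hall_marriage (T U : finType) (u0 : U) (S : {set T}) (N : T -> {set U}) :
  (forall X : {set T}, X \subset S -> #|X| <= #|\bigcup_(x in X) N x|) ->
  exists f : T -> U, {in S, forall x, f x \in N x} /\ {in S &, injective f}.
Proof.
have [m] := ubnP #|S|; elim: m S N => // m IH S N leSm hallN.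
have [->|[x xS]] := set_0Vmem S.
  by exists (fun=> u0); split=> [x|x y]; rewrite inE.
have [/existsP[X /and3P[ltXS X0 tightX]]|] := boolP [exists X : {set T},
    [&& X \proper S, X != set0 & #|\bigcup_(x in X) N x| <= #|X|]].
  have sXS := proper_sub ltXS.
  have ltX : #|X| < m by apply: leq_trans (proper_card ltXS) _.
  have ltD : #|S :\: X| < m.
    move: X0; rewrite -card_gt0 => X0.
    by have := cardsID X S; rewrite (setIidPr sXS); lia.
  have [Y sYX|f1 [f1N f1I]] := IH X N ltX; first by apply/hallN/(subset_trans sYX).
  have [Y sYD|f2 [f2N f2I]] := IH (S :\: X) (fun x => N x :\: \bigcup_(x in X) N x) ltD.
    (* Hall's condition for [Y :|: X], minus the at most [#|X|] neighbours of the tight set [X],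
       leaves at least [#|Y|] points. *)
    have /hallN : Y :|: X \subset S.
      by rewrite subUset sXS andbT (subset_trans sYD) // subsetDl.
    have -> : \bigcup_(x in Y) (N x :\: \bigcup_(x in X) N x) =
              (\bigcup_(x in Y :|: X) N x) :\: \bigcup_(x in X) N x.
      apply/setP => u; rewrite in_setD; apply/bigcupP/andP => [[y yY]|[uX /bigcupP[y]]].
        rewrite in_setD => /andP[-> uy]; split=> //.
        by apply/bigcupP; exists y => //; rewrite inE yY.
      rewrite inE => /orP[yY uy|yX uy]; first by exists y => //; rewrite in_setD uX.
      by case/negP: uX; apply/bigcupP; exists y.
    have -> : #|Y :|: X| = (#|Y| + #|X|)%N.
      have YX0 : Y :&: X = set0.
        by apply/setP => y; rewrite !inE; apply/negP => /andP[/(subsetP sYD)]; rewrite inE => /andP[/negP].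
      by rewrite cardsU YX0 cards0 subn0.
    rewrite cardsD (setIidPr _).
      by move: tightX; set A := #|_|; set B := #|_|; set C := #|_|; set D := #|_|; lia.
    by apply/bigcupsP => z zX; apply: bigcup_sup; rewrite inE zX orbT.
  exists (fun x => if x \in X then f1 x else f2 x); split=> [z zS|y z yS zS].
    case: ifP => zX; first exact: f1N.
    by have := f2N z; rewrite !inE zX zS => /(_ isT) /andP[].
  have f2X t : t \in S -> t \notin X -> f2 t \notin \bigcup_(x in X) N x.
    by move=> tS tX; have := f2N t; rewrite !inE tS tX => /(_ isT) /andP[].
  have f1X t : t \in X -> f1 t \in \bigcup_(x in X) N x.
    by move=> tX; apply/bigcupP; exists t; rewrite ?f1N.
  case: ifPn => yX; case: ifPn => zX E.
  - exact: f1I.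
  - by case/negP: (f2X z zS zX); rewrite -E f1X.
  - by case/negP: (f2X y yS yX); rewrite E f1X.
  - by apply: f2I; rewrite ?inE ?yX ?zX.
rewrite negb_exists => /forallP slack.
have [y yN] : exists y, y \in N x.
  apply/set0Pn; rewrite -card_gt0; have := hallN [set x].
  by rewrite sub1set xS big_set1 cards1 => /(_ isT).
have ltD : #|S :\ x| < m by have := cardsD1 x S; rewrite xS; lia.
have [Y sY|f [fN fI]] := IH (S :\ x) (fun z => N z :\ y) ltD.
  have [->|Y0] := eqVneq Y set0; first by rewrite cards0.
  have ltY : Y \proper S.
    apply/properP; split; first by apply: subset_trans sY _; exact: subD1set.
    by exists x => //; apply/negP => /(subsetP sY); rewrite !inE eqxx.
  have := slack Y; rewrite ltY Y0 /= -ltnNge => ltYN.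
  have -> : \bigcup_(z in Y) (N z :\ y) = (\bigcup_(z in Y) N z) :\ y.
    apply/setP => u; rewrite in_setD1; apply/bigcupP/andP => [[z zY]|[uy /bigcupP[z zY uz]]].
      by rewrite in_setD1 => /andP[-> uz]; split=> //; apply/bigcupP; exists z.
    by exists z; rewrite ?in_setD1 ?uy.
  have := cardsD1 y (\bigcup_(z in Y) N z); move: ltYN.
  by case: (y \in _) => /= + E; rewrite E; lia.
exists (fun z => if z == x then y else f z); split=> [z zS|z t zS tS].
  case: eqP => [->//|/eqP zx].
  by have := fN z; rewrite !inE zx zS => /(_ isT) /andP[].
have fy u : u \in S -> u != x -> f u != y.
  by move=> uS ux; have := fN u; rewrite !inE ux uS => /(_ isT) /andP[].
case: eqVneq => [->|zx]; case: eqVneq => [->|tx] // E.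
- by have := fy t tS tx; rewrite -E eqxx.
- by have := fy z zS zx; rewrite E eqxx.
- by apply: fI; rewrite // !inE ?zx ?tx.
Qed.

Lemma fact_pred m : 0 < m -> m`! = (m * (m - 1)`!)%N.
Proof. by case: m => // m _; rewrite subn1. Qed.

(** * Latin squares and averaging over their translates *)

Section DisjointFamilies.

Variable n : nat.
Implicit Types (G L F : {set {perm 'I_n}}) (p q g : {perm 'I_n}).

Lemma disjP p q : reflect (forall i, p i <> q i) (~~ perm_intersect p q).
Proof.
rewrite negb_exists; apply: (iffP forallP) => h i; first exact/eqP/h.
exact/eqP/h.
Qed.

Lemma pairwise_disjointP G :
  reflect {in G &, forall p q i, p i = q i -> p = q} (pairwise_disjoint G).
Proof.
apply: (iffP forall_inP) => [h p q pG qG i e|h p pG].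
  have /forall_inP/(_ q qG) := h p pG.
  by case: eqVneq => //= _ /disjP/(_ i).
apply/forall_inP => q qG; apply/implyP => npq; apply/disjP => i e.
by case/eqP: npq; apply: h e.
Qed.

(** Join [i] to [j] when no member of [G] sends [i] to [j]. This bipartite graph is regular of
    degree [n - #|G|] on both sides, so counting edges gives Hall's condition, and a perfect
    matching is the required permutation. *)
Lemma disjoint_perm_exists G : pairwise_disjoint G -> #|G| < n ->
  exists p, {in G, forall g, ~~ perm_intersect p g}.
Proof.
move=> /pairwise_disjointP dG ltG; have i0 : 'I_n := Ordinal (leq_ltn_trans (leq0n _) ltG).
pose N i := ~: [set (g : {perm 'I_n}) i | g in G].
have cN i : #|N i| = (n - #|G|)%N.
  by rewrite cardsCs setCK card_ord card_in_imset // => p q pG qG; apply: dG.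
have cN' j : #|[set i | j \in N i]| = (n - #|G|)%N.
  have -> : [set i | j \in N i] = ~: [set (g^-1 : {perm 'I_n}) j | g in G].
    apply/setP => i; rewrite !inE; congr (~~ _).
    apply/imsetP/imsetP => -[g gG ->]; exists g => //; by rewrite ?permK ?permKV.
  rewrite cardsCs setCK card_ord card_in_imset // => p q pG qG /= e.
  by apply: (dG p q pG qG (p^-1 j)); rewrite permKV {1}e permKV.
have [X _|f [fN fI]] := @hall_marriage _ _ i0 [set: 'I_n] N.
  have k0 : 0 < n - #|G| by rewrite subn_gt0.
  rewrite -(leq_pmul2r k0).
  have -> : (#|X| * (n - #|G|) = \sum_(i in X) \sum_(j | j \in N i) 1)%N.
    by rewrite -sum_nat_const; apply: eq_bigr => i _; rewrite sum1_card cN.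
  rewrite -sum_nat_const (exchange_big_dep (mem (\bigcup_(i in X) N i))) /=.
    apply: leq_sum => j _; rewrite -(cN' j) sum1_card; apply: subset_leq_card.
    by apply/subsetP => i /andP[_ jN]; rewrite in_set.
  by move=> i j iX jN; apply/bigcupP; exists i.
have fI' : injective f by move=> i j; apply: fI; rewrite inE.
exists (perm fI') => g gG; apply/disjP => i e.
have := fN i (in_setT i); rewrite inE => /imsetP; apply.
by exists g => //; rewrite -e permE.
Qed.

Lemma latin_square_extends G : pairwise_disjoint G -> #|G| <= n ->
  exists L, [/\ G \subset L, pairwise_disjoint L & #|L| = n].
Proof.
have [m] := ubnP (n - #|G|)%N; elim: m G => // m IH G ltm dG.
rewrite leq_eqVlt => /orP[/eqP cG|ltG]; first by exists G.
have [p pG] := disjoint_perm_exists dG ltG.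
have i0 : 'I_n := Ordinal (leq_ltn_trans (leq0n _) ltG).
have npG : p \notin G by apply/negP => /pG/disjP/(_ i0).
have [||| L [sL dL cL]] := IH (p |: G); rewrite ?cardsU1 ?npG; try lia.
  apply/pairwise_disjointP => q r /setU1P[->|qG] /setU1P[->|rG] i // e.
  - by have /disjP/(_ i) := pG r rG.
  - by have /disjP/(_ i) := pG q qG; rewrite e.
  - by have /pairwise_disjointP/(_ q r qG rG i e) := dG.
by exists L; split=> //; apply: subset_trans sL; exact: subsetUr.
Qed.

Lemma nu_ge G F : G \subset F -> pairwise_disjoint G -> #|G| <= nu F.
Proof. by move=> sG dG; apply: (@leq_bigmax_cond _ _ (fun G => #|G|)); rewrite sG. Qed.

Lemma pairwise_disjoint_mulr G g : pairwise_disjoint G -> pairwise_disjoint (G :* g).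
Proof.
move=> /pairwise_disjointP dG; apply/pairwise_disjointP.
move=> _ _ /rcosetP[p pG ->] /rcosetP[q qG ->] i; rewrite !permM => /perm_inj e.
by rewrite (dG p q pG qG i e).
Qed.

(** Double counting: [p] lies in [L :* g] exactly when [g = q^-1 * p] for some [q] in [L], hence for
    [#|L|] values of [g]. *)
Lemma card_translates F L :
  \sum_g #|F :&: L :* g| = (#|F| * #|L|)%N.
Proof.
have -> : \sum_g #|F :&: L :* g| = \sum_(p in F) \sum_g (p \in L :* g : nat).
  rewrite exchange_big; apply: eq_bigr => g _.
  rewrite -sum1_card big_mkcond [RHS]big_mkcond; apply: eq_bigr => p _.
  by rewrite inE; case: (p \in F); case: (p \in _).
rewrite -sum_nat_const; apply: eq_bigr => p pF.
rewrite -big_mkcond -sum1_card /=.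
rewrite (reindex_onto (fun q => q^-1 * p) (fun g => p * g^-1)) /=.
  apply: eq_bigl => q; rewrite mem_rcoset invMg invgK mulgA mulgV mul1g.
  by rewrite eqxx andbT.
by move=> g _; rewrite invMg invgK mulgKV.
Qed.

Lemma card_translate_lt F L g s : pairwise_disjoint L -> nu F < s ->
  #|F :&: L :* g| <= s - 1.
Proof.
move=> dL nuF; have dLg := pairwise_disjoint_mulr g dL.
have : #|F :&: L :* g| <= nu F.
  apply: nu_ge; first exact: subsetIl.
  apply/pairwise_disjointP => p q; rewrite !in_setI => /andP[_ pL] /andP[_ qL].
  by apply: (pairwise_disjointP _ dLg).
by lia.
Qed.

Lemma card_nu_bound F s : 0 < n -> nu F < s -> #|F| <= (s - 1) * (n - 1)`!.
Proof.
move=> n0 nuF; have [||L [_ dL cL]] := @latin_square_extends set0.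
- by apply/pairwise_disjointP => p q; rewrite inE.
- by rewrite cards0.
have := card_translates F L; rewrite cL => E.
have : (#|F| * n <= n`! * (s - 1))%N.
  rewrite -E; apply: (@leq_trans (\sum_(g : {perm 'I_n}) (s - 1)%N)).
    by apply: leq_sum => g _; apply: card_translate_lt.
  by rewrite sum_nat_const card_Sn.
by rewrite (fact_pred n0) mulnC -mulnA leq_pmul2l // mulnC.
Qed.

Lemma card_latin_square_eq F L s : 0 < n -> nu F < s ->
    #|F| = ((s - 1) * (n - 1)`!)%N -> pairwise_disjoint L -> #|L| = n ->
  #|F :&: L| = (s - 1)%N.
Proof.
move=> n0 nuF cF dL cL.
have E : \sum_(g : {perm 'I_n}) #|F :&: L :* g| = \sum_(g : {perm 'I_n}) (s - 1)%N.
  rewrite card_translates cF cL sum_nat_const card_Sn.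
  by rewrite (fact_pred n0); move: (_`!) => B; nia.
(* Termwise bounds whose sums agree are all equalities; the translate by [1] is [L] itself. *)
have := @leqif_sum _ xpredT (fun g => #|F :&: L :* g| == (s - 1)%N) _ _
  (fun g _ => leqif_eq (card_translate_lt g dL nuF)).
by case=> _; rewrite E eqxx => /esym/forallP/(_ 1); rewrite rcoset1 => /eqP.
Qed.

End DisjointFamilies.

(** * Auxiliary facts on fresh indices, cycles and transpositions *)

Lemma ord_fresh n (s : seq 'I_n) : size s < n -> exists g, g \notin s.
Proof.
move=> lt; case: (pickP [pred g | g \notin s]) => [g|none]; first by exists g.
have : [set: 'I_n] \subset s by apply/subsetP => g _; have := none g => /negbFE.
move/subset_leq_card; rewrite cardsT card_ord => /leq_trans/(_ (card_size s)).
by rewrite leqNgt lt.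
Qed.

(** Transpositions of positions outside [Z] lead from [s] to [t], by induction on the number of
    positions where they differ. *)
Lemma tperm_connected (T : finType) (U : Type) (Z : {set T}) (P : {perm T} -> U) :
  (forall s i j, i \notin Z -> j \notin Z -> P (tperm i j * s) = P s) ->
  forall s t : {perm T}, {in Z, s =1 t} -> P s = P t.
Proof.
move=> inv s t; have [m] := ubnP #|[set i | s i != t i]|.
elim: m s => // m IH s ltm st.
case: (pickP [pred i | s i != t i]) => [i /= ist|e]; last first.
  by congr P; apply/permP => i; apply/eqP/negbFE/e.
(* Swapping [i] with the position where [s] takes the value [t i] repairs [i]. Since [s] and [t]
   differ at [j] too, no agreement is lost and [j] is outside [Z]. *)
pose j := s^-1 (t i).
have sj : s j = t i by rewrite /j permKV.
have ij : j != i by apply: contra_neq ist => e; rewrite -sj e.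
have iZ : i \notin Z by apply: contra ist => /st ->.
have jst : s j != t j by rewrite sj (inj_eq perm_inj) eq_sym.
have jZ : j \notin Z by apply: contra jst => /st ->.
rewrite -(inv s i j) //; apply: IH => [|k kZ].
  rewrite -ltnS; apply: leq_trans ltm; rewrite ltnS; apply: proper_card; apply/properP; split.
    apply/subsetP => k; rewrite !inE permM.
    by case: tpermP => [->|->|//]; rewrite ?ist.
  by exists i; rewrite inE ?permM ?tpermL ?sj ?eqxx.
by rewrite permM tpermD ?st //; [apply: contraNneq iZ | apply: contraNneq jZ] => ->.
Qed.

Lemma next_neq (T : eqType) (s : seq T) x :
  uniq s -> 1 < size s -> x \in s -> next s x != x.
Proof.
move=> us s1 xs; have [i s' e] := rot_to xs.
rewrite -(next_rot i us) e; have := us; rewrite -(rot_uniq i) e.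
have : 1 < size (rot i s) by rewrite size_rot.
by rewrite e; case: s' {e} => //= y s' _; rewrite eqxx inE negb_or eq_sym => /andP[/andP[]].
Qed.

Lemma next_notin (T : eqType) (s : seq T) x : x \notin s -> next s x = x.
Proof. by move=> xs; rewrite next_nth (negbTE xs). Qed.

Lemma perm_map_exists (T : finType) (l m : seq T) :
  uniq l -> uniq m -> size l = size m -> exists p : {perm T}, map p l = m.
Proof.
elim: l m => [|a l IH] [|x m] //= => [_ _ _|]; first by exists 1.
case/andP=> al ul /andP[xm um] [sz]; have [p pl] := IH m ul um sz.
exists (p * tperm (p a) x); rewrite permM tpermL -[in RHS]pl; congr (_ :: _).
apply/eq_in_map => i il; rewrite permM tpermD //.
  by rewrite (inj_eq perm_inj); apply: contraNneq al => ->.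
by apply: contraNneq xm => ->; rewrite -pl map_f.
Qed.

Lemma tperm_braid (T : finType) (a b c : T) : a != b -> a != c -> b != c ->
  tperm a b * tperm a c = tperm b c * tperm a b.
Proof.
move=> ab ac bc; have ca : c != a by rewrite eq_sym.
have cb : c != b by rewrite eq_sym.
have ba : b != a by rewrite eq_sym.
apply/permP => i; rewrite !permM.
have [->|ia] := eqVneq i a; first by rewrite tpermL (tpermD ab cb) (tpermD ba ca) tpermL.
have [->|ib] := eqVneq i b; first by rewrite tpermR !tpermL tpermD // 1?eq_sym.
have [->|ic] := eqVneq i c; first by rewrite (tpermD ac bc) !tpermR.
by rewrite !tpermD // 1?eq_sym.
Qed.

(** * From the trade identity to a matrix describing the effect of swaps *)

Section Additive.

Variables (n : nat) (f : {perm 'I_n} -> int).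
Hypothesis n8 : 8 <= n.
Hypothesis trade : forall p q p' q' : {perm 'I_n}, (forall i, p i <> q i) ->
  (forall i, p' i = p i /\ q' i = q i \/ p' i = q i /\ q' i = p i) ->
  (f p + f q = f p' + f q')%R.

Let d a b (s : {perm 'I_n}) : int := (f (tperm a b * s) - f s)%R.

(** Trade the disjoint pair [s], [tperm a b * t] for the pair [tperm a b * s], [t]: both have the
    same union of graphs. *)
Lemma swap_step a b (s t : {perm 'I_n}) : a != b -> s a = t a -> s b = t b ->
  (forall i, i != a -> i != b -> s i != t i) -> d a b s = d a b t.
Proof.
move=> ab sa sb st.
have := @trade s (tperm a b * t) (tperm a b * s) t; rewrite /d.
have H1 i : s i <> (tperm a b * t) i.
  rewrite permM; case: tpermP => [->|->|/eqP ia /eqP ib].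
  - by rewrite -sb => /perm_inj/eqP; rewrite (negbTE ab).
  - by rewrite -sa => /perm_inj/esym/eqP; rewrite (negbTE ab).
  - exact/eqP/st.
have H2 i : (tperm a b * s) i = s i /\ t i = (tperm a b * t) i \/
            (tperm a b * s) i = (tperm a b * t) i /\ t i = s i.
  rewrite !permM; case: tpermP => [->|->|/eqP ia /eqP ib]; last by left.
  - by right; rewrite sb sa.
  - by right; rewrite sb sa.
by move=> /(_ H1 H2); lia.
Qed.

(** The permutations [s] and [tperm c e * s] may agree off [a] and [b], so [swap_step] is applied
    twice, through an intermediate permutation [q * s] that agrees with either of them at [a] and
    [b] only. *)
Lemma swap_tperm a b c e (s : {perm 'I_n}) : a != b -> c \notin [set a; b] ->
  e \notin [set a; b] -> d a b (tperm c e * s) = d a b s.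
Proof.
rewrite !inE !negb_or => ab /andP[ca cb] /andP[ea eb].
have [->|ce] := eqVneq c e; first by rewrite tperm1 mul1g.
have [g] := @ord_fresh n [:: a; b; c; e] (leq_trans (isT : 4 < 8) n8).
rewrite !inE !negb_or => /and4P[ga gb gc ge].
have [h] := @ord_fresh n [:: a; b; c; e; g] (leq_trans (isT : 5 < 8) n8).
rewrite !inE !negb_or => /and5P[ha hb hc he hg].
pose r := [seq i <- enum 'I_n | i \notin [:: a; b; c; e; g; h]].
(* The cycle [q] along [l] moves every point except [a] and [b]. It sends [c] to [g] and [e] to [h],
   hence also differs from [tperm c e] at [c] and at [e]. *)
pose l := [:: c, g, e, h & r].
have ul : uniq l.
  rewrite /l /= !inE !mem_filter !inE !eqxx !orbT /= filter_uniq ?enum_uniq // !andbT !orbF.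
  by rewrite !negb_or ce [c == g]eq_sym gc [c == h]eq_sym hc [g == h]eq_sym hg [e == h]eq_sym he ge.
have ql : injective (next l) := can_inj (prev_next ul).
have ml i : (i \in l) = (i != a) && (i != b).
  rewrite !inE mem_filter mem_enum andbT !inE !negb_or.
  have [->|] := eqVneq i c; first by rewrite ca cb.
  have [->|] := eqVneq i g; first by rewrite ga gb.
  have [->|] := eqVneq i e; first by rewrite ea eb.
  have [->|] := eqVneq i h; first by rewrite ha hb.
  by rewrite !andbT.
pose q := perm ql.
have qa : q a = a by rewrite permE next_notin // ml eqxx.
have qb : q b = b by rewrite permE next_notin // ml eqxx andbF.
have qc : q c = g by rewrite permE /= eqxx.
have qe : q e = h by rewrite permE /= [e == c]eq_sym (negbTE ce) [e == g]eq_sym (negbTE ge) eqxx.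
transitivity (d a b (q * s)); [|symmetry]; apply: swap_step => //; rewrite ?permM ?qa ?qb ?tpermD //.
- move=> i ia ib; rewrite !permM (inj_eq perm_inj); case: tpermP => [->|->|/eqP ic /eqP ie].
  + by rewrite qc eq_sym.
  + by rewrite qe eq_sym.
  + by rewrite permE eq_sym next_neq // ml ia.
- by move=> i ia ib; rewrite !permM (inj_eq perm_inj) permE eq_sym next_neq // ml ia.
Qed.

Lemma swap_local a b (s t : {perm 'I_n}) : a != b -> s a = t a -> s b = t b ->
  d a b s = d a b t.
Proof.
move=> ab sa sb; apply: (@tperm_connected _ _ [set a; b]).
  by move=> u i j iZ jZ; apply: swap_tperm.
by move=> i; rewrite !inE => /orP[]/eqP->.
Qed.


(** For [a != b] and [x != y] the displayed product of transpositions is one permutation sending [a]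
    to [x] and [b] to [y]; by [swap_local] the choice is immaterial. The default 0 on the diagonal
    lets the identities below hold without distinctness assumptions. *)
Let D a b x y : int :=
  if x == y then 0%R else d a b (tperm a x * tperm (tperm a x b) y).

Lemma swapE a b (s : {perm 'I_n}) : d a b s = D a b (s a) (s b).
Proof.
rewrite /D (inj_eq perm_inj); have [->|ab] := eqVneq a b.
  by rewrite /d tperm1 mul1g; lia.
apply: swap_local => //; rewrite !permM.
- rewrite tpermL tpermD // ?(inj_eq perm_inj) 1?eq_sym //.
  by apply: contra_neq ab => e; apply: (@perm_inj _ (tperm a (s a))); rewrite tpermL.
- by rewrite tpermL.
Qed.

Lemma D_refl a x y : D a a x y = 0%R.
Proof. by rewrite /D /d tperm1 mul1g; case: eqP => // _; lia. Qed.

Lemma D_diag a b x : D a b x x = 0%R.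
Proof. by rewrite /D eqxx. Qed.

Lemma D_sym a b x y : D b a y x = D a b x y.
Proof.
have [->|xy] := eqVneq x y; first by rewrite !D_diag.
have [->|ab] := eqVneq a b; first by rewrite !D_refl.
have [||//|s [<- <-]] := @perm_map_exists _ [:: a; b] [:: x; y].
- by rewrite /= inE ab.
- by rewrite /= inE xy.
by rewrite -!swapE /d tpermC.
Qed.

Lemma D_antisym a b x y : D a b y x = (- D a b x y)%R.
Proof.
have [->|xy] := eqVneq x y; first by rewrite !D_diag.
have [->|ab] := eqVneq a b; first by rewrite !D_refl.
have [||//|s [<- <-]] := @perm_map_exists _ [:: a; b] [:: x; y].
- by rewrite /= inE ab.
- by rewrite /= inE xy.
have := swapE a b (tperm a b * s); rewrite !permM tpermL tpermR => <-.
by rewrite -swapE /d mulgA tperm2 mul1g; lia.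
Qed.

(* The three sums equal the alternating sum of [f] over the six ways of
   sending [a], [b], [c] to [x], [y], [z]. *)
Lemma D_hexagon a b c x y z : uniq [:: a; b; c] -> uniq [:: x; y; z] ->
  (D a b x y + D a b y z + D a b z x = D b c x y + D b c y z + D b c z x /\
   D a b x y + D a b y z + D a b z x = D a b x y + D b c x y + D c a x y)%R.
Proof.
move=> Ua Ux; have [//|s [sa sb sc]] := perm_map_exists Ua Ux.
move: Ua; rewrite /= !inE negb_or andbT => /andP[/andP[ab ac] bc].
have ba : b != a by rewrite eq_sym.
have ca : c != a by rewrite eq_sym.
have cb : c != b by rewrite eq_sym.
(* The six arrangements form a complete bipartite graph between even and odd ones, whose nine edges
   are these swaps. The braid relations below give each 3-cycle a single name. *)
have := swapE a b s; have := swapE a b (tperm a c * s).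
have := swapE a b (tperm b c * s); have := swapE b c s.
have := swapE b c (tperm a b * s); have := swapE b c (tperm a c * s).
have := swapE a c (tperm b c * s); have := swapE a c s.
have := swapE a c (tperm a b * s).
rewrite /d !mulgA.
have -> : tperm b c * tperm a b = tperm a b * tperm a c by rewrite tperm_braid.
have -> : tperm a c * tperm b c = tperm a b * tperm a c.
  by rewrite ![tperm _ c]tpermC tperm_braid.
have -> : tperm a c * tperm a b = tperm a b * tperm b c.
  by rewrite [tperm a b]tpermC tperm_braid.
have -> : tperm b c * tperm a c = tperm a b * tperm b c.
  by rewrite ![tperm _ c]tpermC tperm_braid // [tperm b a]tpermC.
rewrite !permM !(tpermL, tpermR, tpermD ac bc, tpermD ab cb, tpermD ba ca) sa sb sc.
move: (D_antisym a b y z) (D_antisym a b x z) (D_antisym b c z x).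
move: (D_antisym b c x y) (D_antisym a c x y) (D_sym a c y x).
move: (f s) (f (_ * s)) (f (_ * s)) (f (_ * s)) (f (_ * s)) (f (_ * s)); lia.
Qed.

(** Write [S a b] for the sum. The hexagon gives [S a b = S b c] for distinct rows, and [S] changes
    sign when its rows are exchanged. With fresh rows [c] and [e], [S a b = S b c = - S c b = - S b
    e = - S a b], so the sum is 0. *)
Lemma D_cocycle_col_distinct a b x y z : a != b -> uniq [:: x; y; z] ->
  (D a b x y + D a b y z + D a b z x = 0)%R.
Proof.
move=> ab Ux.
have [c] := @ord_fresh n [:: a; b] (leq_trans (isT : 2 < 8) n8).
rewrite !inE !negb_or => /andP[ca cb].
have [e] := @ord_fresh n [:: a; b; c] (leq_trans (isT : 3 < 8) n8).
rewrite !inE !negb_or => /and3P[ea eb ec].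
have [||H1 _] := @D_hexagon a b c x y z; rewrite //= ?inE ?negb_or ?ab ?[_ == c]eq_sym ?ca ?cb //.
have [||H2 _] := @D_hexagon a b e x y z; rewrite //= ?inE ?negb_or ?ab ?[_ == e]eq_sym ?ea ?eb //.
have [||H3 _] := @D_hexagon c b e x y z; rewrite //= ?inE ?negb_or ?cb ?[_ == e]eq_sym ?ec ?eb //.
move: (D_sym c b x y) (D_sym c b y z) (D_sym c b z x).
by move: (D_antisym b c x y) (D_antisym b c y z) (D_antisym b c z x); lia.
Qed.

Lemma D_cocycle_col a b x y z : (D a b x y + D a b y z = D a b x z)%R.
Proof.
have [->|ab] := eqVneq a b; first by rewrite !D_refl.
have [->|xy] := eqVneq x y; first by rewrite D_diag; lia.
have [->|yz] := eqVneq y z; first by rewrite D_diag; lia.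
have [->|xz] := eqVneq x z; first by rewrite D_antisym D_diag; lia.
have := @D_cocycle_col_distinct a b x y z ab.
by rewrite /= !inE !negb_or xy xz yz => /(_ isT); rewrite (D_antisym a b x z); lia.
Qed.

Lemma D_cocycle_row a b c x y : (D a b x y + D b c x y = D a c x y)%R.
Proof.
have [->|xy] := eqVneq x y; first by rewrite !D_diag.
have [->|ab] := eqVneq a b; first by rewrite D_refl; lia.
have [->|bc] := eqVneq b c; first by rewrite D_refl; lia.
have Dac : (D c a x y = - D a c x y)%R by rewrite D_sym D_antisym.
have [ac|ac] := eqVneq a c.
  by rewrite -ac D_refl (D_sym a b y x) (D_antisym a b x y); lia.
have [z] := @ord_fresh n [:: x; y] (leq_trans (isT : 2 < 8) n8).
rewrite !inE !negb_or => /andP[zx zy].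
have Ux : uniq [:: x; y; z] by rewrite /= !inE !negb_or xy ![_ == z]eq_sym zx zy.
have Ua : uniq [:: a; b; c] by rewrite /= !inE !negb_or ab ac bc.
by have [_] := D_hexagon Ua Ux; rewrite D_cocycle_col_distinct //; lia.
Qed.

Lemma swap_matrix : exists w : 'I_n -> 'I_n -> int, forall (s : {perm 'I_n}) a b,
  (f (tperm a b * s) - f s =
   (w b (s a) - w a (s a)) - (w b (s b) - w a (s b)))%R.
Proof.
pose o : 'I_n := Ordinal (leq_trans (isT : 0 < 8) n8).
(* As [D] is additive in its rows and in its values, it has a potential, normalised at row [o] and
   value [o]. *)
exists (fun a x => D o a x o) => s a b; rewrite -[LHS]/(d a b s) swapE.
move: (D_cocycle_col a b (s a) o (s b)) (D_antisym a b o (s b)).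
by move: (D_cocycle_row o a b (s a) o) (D_cocycle_row o a b (s b) o); lia.
Qed.

End Additive.

(** * Two functions such that any pair separated by one meets any pair separated by the other *)

Section CommonPoint.

Variables (n : nat) (g h : 'I_n -> int).
Hypothesis n8 : 8 <= n.
Hypothesis meet : forall x y z t, uniq [:: x; y; z; t] -> g x <> g y -> h z = h t.

Definition const_off (k : 'I_n -> int) u := forall x y, x != u -> y != u -> k x = k y.

(** If [g] separated [p] and [q] off [u], take a fresh [t]: the pair [u], [v] forces [h z = h t], so
    [h] separates [u] from [t], a pair disjoint from [p], [q]. Once [g] is constant off [u], it
    separates [u] from every other point, which forces [h] to be constant off [u]. *)
Lemma const_off_pivot u v z : z != u -> z != v -> g u <> g v -> h u <> h z ->
  const_off g u /\ const_off h u.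
Proof.
move=> zu zv guv huz.
have uv : u != v by apply/eqP => e; apply: guv; rewrite e.
have gu : const_off g u.
  move=> p q pu qu; apply/eqP/contraT => /eqP gpq.
  have pq : p != q by apply/eqP => e; apply: gpq; rewrite e.
  have [t] := @ord_fresh n [:: u; v; p; q; z] (leq_trans (isT : 5 < 8) n8).
  rewrite !inE !negb_or => /and5P[tu tv tp tq tz].
  have hzt : h z = h t.
    apply: meet guv; rewrite /= !inE !negb_or uv ![_ == t]eq_sym tu tv tz.
    by rewrite ![_ == z]eq_sym zu zv.
  case: huz; rewrite hzt; apply: meet gpq.
  by rewrite /= !inE !negb_or pq pu qu ![_ == t]eq_sym tu tp tq.
split=> // p q pu qu; have [->//|pq] := eqVneq p q.
have [t] := @ord_fresh n [:: u; p; q] (leq_trans (isT : 3 < 8) n8).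
rewrite !inE !negb_or => /and3P[tu tp tq].
apply: (@meet u t); last by rewrite (gu t v) // eq_sym.
by rewrite /= !inE !negb_or pq tp tq ![u == _]eq_sym tu pu qu.
Qed.

(** The function [h] is constant off [x] and [y]; as it is not constant, its value at one of these
    two differs from the common value, and that point serves as the pivot. *)
Lemma common_point x y x' y' : g x <> g y -> h x' <> h y' ->
  exists u, const_off g u /\ const_off h u.
Proof.
move=> gxy hxy.
have [z] := @ord_fresh n [:: x; y] (leq_trans (isT : 2 < 8) n8).
rewrite !inE !negb_or => /andP[zx zy].
have xy : x != y by apply/eqP => e; apply: gxy; rewrite e.
have hz t : t != x -> t != y -> h t = h z.
  move=> tx ty; have [->//|tz] := eqVneq t z.
  apply: meet gxy; rewrite /= !inE !negb_or xy tz ![x == _]eq_sym ![y == _]eq_sym.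
  by rewrite tx zx ty zy.
have [hx|/eqP hx] := eqVneq (h x) (h z); last by exists x; apply: (@const_off_pivot x y z).
have [hy|/eqP hy] := eqVneq (h y) (h z).
  have hc t : h t = h z.
    by have [->//|tx] := eqVneq t x; have [->//|ty] := eqVneq t y; apply: hz.
  by case: hxy; rewrite !hc.
by exists y; apply: (@const_off_pivot y x z) => //; exact: nesym.
Qed.

End CommonPoint.

(** * Nonzero minors sharing a row or a column *)

Section MatrixDictator.

Variables (n : nat) (w : 'I_n -> 'I_n -> int).
Hypothesis n8 : 8 <= n.
Let dl a b x : int := (w b x - w a x)%R.
Hypothesis meet : forall a b c e x y z t,
  uniq [:: a; b; c; e] -> uniq [:: x; y; z; t] -> dl a b x <> dl a b y ->
  dl c e z = dl c e t.

Let active a b := [exists x, exists y, dl a b x != dl a b y].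

Lemma activeP a b : reflect (exists x y, dl a b x <> dl a b y) (active a b).
Proof.
apply: (iffP existsP) => [[x /existsP[y /eqP xy]]|[x [y xy]]]; first by exists x, y.
by exists x; apply/existsP; exists y; apply/eqP.
Qed.

Lemma inactive a b x y : ~~ active a b -> dl a b x = dl a b y.
Proof.
by move/activeP=> H; apply/eqP/contraT => /eqP e; case: H; exists x, y.
Qed.

Lemma active_sym a b : active a b = active b a.
Proof. by apply/activeP/activeP => -[x [y e]]; exists x, y; move: e; rewrite /dl; lia. Qed.

(** Disjoint active pairs have a common exceptional column, which is unique for each active pair, so
    every pair of rows disjoint from [a], [b] or from [c], [e] inherits [u]. Any other [dl i j] is
    [dl i k - dl j k] with [k] a fresh row. *)
Lemma const_off_column a b c e : uniq [:: a; b; c; e] -> active a b -> active c e ->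
  exists u, forall i j, const_off (dl i j) u.
Proof.
move=> U Aab Ace.
have common i j k l : uniq [:: i; j; k; l] -> active i j -> active k l ->
    exists u, const_off (dl i j) u /\ const_off (dl k l) u.
  move=> U' /activeP[x [y xy]] /activeP[x' [y' xy']].
  apply: (common_point n8 _ xy xy') => p q r t Ux; exact: meet.
have [u [uab uce]] := common a b c e U Aab Ace; exists u.
have unique_u i j v : active i j -> const_off (dl i j) u -> const_off (dl i j) v -> u = v.
  move=> /activeP[x [y xy]] cu cv; apply/eqP/contraT => uv; case: xy.
  have [t] := @ord_fresh n [:: u; v] (leq_trans (isT : 2 < 8) n8).
  rewrite !inE negb_or => /andP[tu tv].
  have E z : dl i j z = dl i j t.
    have [->|zu] := eqVneq z u; first exact: cv.
    exact: cu.
  by rewrite !E.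
have meets k l i j : active k l -> const_off (dl k l) u -> uniq [:: k; l; i; j] ->
    const_off (dl i j) u.
  move=> Akl ukl U'; have [Aij|nA] := boolP (active i j); last first.
    by move=> x y _ _; apply: inactive.
  have [v [vkl vij]] := common k l i j U' Akl Aij.
  by rewrite (unique_u k l v).
move: U; rewrite /= !inE !negb_or => /and4P[/and3P[ab ac ae] /andP[bc be] ce _].
have fresh i k : k \notin [:: a; b; c; e; i] -> const_off (dl i k) u.
  rewrite !inE !negb_or => /and5P[ka kb kc ke ki].
  have [/orP iab|/norP[ia ib]] := boolP ((i == a) || (i == b)).
    apply: (meets c e) => //; rewrite /= !inE !negb_or ce ![_ == k]eq_sym kc ke ki.
    by case: iab => /eqP->; [rewrite ![_ == a]eq_sym ac ae | rewrite ![_ == b]eq_sym bc be].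
  apply: (meets a b) => //; rewrite /= !inE !negb_or ab ![_ == k]eq_sym ka kb ki.
  by rewrite ![_ == i]eq_sym ia ib.
move=> i j x y xu yu.
have [k] := @ord_fresh n [:: a; b; c; e; i; j] (leq_trans (isT : 6 < 8) n8).
rewrite !inE !negb_or => /and5P[ka kb kc ke /andP[ki kj]].
have := fresh i k; have := fresh j k; rewrite !inE !negb_or ka kb kc ke ki kj.
move=> /(_ isT x y xu yu) E1 /(_ isT x y xu yu); move: E1; rewrite /dl; clear; lia.
Qed.

(** View active pairs as edges of a graph on the rows. Two disjoint edges yield a common column.
    Otherwise the edges pairwise meet, so they form a star, whose centre is the common row, or a
    triangle, which is excluded. *)
Lemma matrix_dictator :
  (exists i, forall a b, a != i -> b != i -> forall x y, dl a b x = dl a b y) \/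
  (exists u, forall a b, const_off (dl a b) u).
Proof.
pose o : 'I_n := Ordinal (leq_trans (isT : 0 < 8) n8).
have [/existsP[a /existsP[b Aab]]|none] := boolP [exists a, exists b, active a b]; last first.
  left; exists o => a b _ _ x y; apply: inactive.
  by move: none; rewrite negb_exists => /forallP/(_ a); rewrite negb_exists => /forallP/(_ b).
have [/existsP[c /existsP[e /existsP[a' /existsP[b' /and3P[U A1 A2]]]]]|none] :=
  boolP [exists c, exists e, exists a', exists b',
    [&& uniq [:: c; e; a'; b'], active c e & active a' b']].
  by right; apply: const_off_column U A1 A2.
have cross c e a' b' : uniq [:: c; e; a'; b'] -> active c e -> ~~ active a' b'.
  move=> U A1; apply: contra none => A2.
  by apply/existsP; exists c; apply/existsP; exists e; apply/existsP; exists a';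
     apply/existsP; exists b'; rewrite U A1.
left.
have irrefl c : ~~ active c c.
  by apply/activeP => -[x [y]]; rewrite /dl; lia.
have ab : a != b by apply/eqP => e; move: Aab; rewrite e (negbTE (irrefl b)).
(* If row [a] misses an active pair then this pair is [{b, c}]; a pair missing
   [b] would be [{a, c}], and a row outside the triangle [{a, b, c}] shows that
   [{a, b}] is not active. *)
have meetab c e : c != a -> e != a -> active c e -> (c == b) || (e == b).
  move=> ca ea Ace; apply/contraT; rewrite negb_or => /andP[cb eb].
  have ce : c != e by apply/eqP => E; move: Ace; rewrite E (negbTE (irrefl e)).
  suff U : uniq [:: a; b; c; e] by move: (cross a b c e U Aab); rewrite Ace.
  by rewrite /= !inE !negb_or ab ce ![a == _]eq_sym ![b == _]eq_sym ca ea cb eb.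
have meetba c e : c != b -> e != b -> active c e -> (c == a) || (e == a).
  move=> cb eb Ace; apply/contraT; rewrite negb_or => /andP[ca ea].
  by have := meetab c e ca ea Ace; rewrite (negbTE cb) (negbTE eb).
have [/existsP[c /andP[ca Abc]]|noc] := boolP [exists c, (c != a) && active b c].
  exists b => i j ib jb x y; apply: inactive; apply/negP => Aij.
  have cb : c != b by apply/eqP => E; move: Abc; rewrite E (negbTE (irrefl b)).
  have [k kb Aak] : exists2 k, k != b & active a k.
    have /orP[/eqP ia|/eqP ja] := meetba i j ib jb Aij; first by exists j; rewrite -?ia.
    by exists i; rewrite // active_sym -ja.
  have ka : k != a by apply/eqP => E; move: Aak; rewrite E (negbTE (irrefl a)).
  have kc : k = c.
    apply/eqP/contraT => kc.
    suff U : uniq [:: b; c; a; k] by move: (cross b c a k U Abc); rewrite Aak.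
    by rewrite /= !inE !negb_or [b == a]eq_sym [b == c]eq_sym [b == k]eq_sym ab cb kb ca
       [c == k]eq_sym kc [a == k]eq_sym ka.
  rewrite {}kc in Aak kb ka.
  have [t] := @ord_fresh n [:: a; b; c] (leq_trans (isT : 3 < 8) n8).
  rewrite !inE !negb_or => /and3P[ta tb tc].
  have Nat : ~~ active a t.
    apply: cross Abc; rewrite /= !inE !negb_or [b == c]eq_sym cb [b == a]eq_sym ab.
    by rewrite ![_ == t]eq_sym tb tc ta ca.
  have Nbt : ~~ active b t.
    apply: cross Aak; rewrite /= !inE !negb_or [a == c]eq_sym ca ab.
    by rewrite ![_ == t]eq_sym tb tc ta cb.
  case/activeP: Aab => p [q]; apply.
  (* Here [dl a b = dl a t - dl b t] is a difference of two constant functions. *)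
  move: (inactive p q Nat) (inactive p q Nbt); rewrite /dl; clear; lia.
exists a => i j ia ja x y; apply: inactive; apply/negP => Aij.
case/negP: noc; apply/existsP.
have /orP[/eqP ib|/eqP jb] := meetab i j ia ja Aij.
  by exists j; rewrite ja -ib.
by exists i; rewrite ia active_sym -jb.
Qed.

End MatrixDictator.

(** Since [ln n > 1/2] and [s >= 2], the hypothesis makes [n] at least 2^17. The bound 8 leaves room
    for the fresh indices chosen in the arguments above. *)
Lemma s_bound_ge8 n s : 2 <= n -> 2 <= s -> s_bound n s -> 8 <= n.
Proof.
move=> /leP n2 /leP s2; rewrite /s_bound => H.
have Rn : (2 <= INR n)%Re by have := le_INR _ _ n2.
have Rs : (2 <= INR s)%Re by have := le_INR _ _ s2.
have ln2 : (/ 2 < ln (INR n))%Re.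
  apply: Rlt_le_trans ln_lt_2 _; case: (Req_dec 2 (INR n)) => [->|ne]; first exact: Rle_refl.
  by apply: Rlt_le; apply: ln_increasing; lra.
have E17 : (INR 2 ^ 17 = 131072)%Re by rewrite /=; lra.
have pos : (0 < 131072 * ln (INR n))%Re by lra.
have {}H : (INR s * (131072 * ln (INR n)) <= INR n)%Re.
  move: H; rewrite E17 => H.
  apply: (Rle_trans _ (INR n / (131072 * ln (INR n)) * (131072 * ln (INR n)))).
    by apply: Rmult_le_compat_r H; lra.
  by apply: Req_le; field; lra.
apply/leP; apply: INR_le.
have -> : INR 8 = 8%Re by rewrite /=; lra.
by nra.
Qed.

(** * Families meeting every Latin square in the same number of permutations *)

Section Equality.

Variables (n k : nat) (F : {set {perm 'I_n}}).
Hypothesis n8 : 8 <= n.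
Hypothesis latinF : forall L : {set {perm 'I_n}},
  pairwise_disjoint L -> #|L| = n -> #|F :&: L| = k.

Lemma cardI_pair (p q : {perm 'I_n}) (L : {set {perm 'I_n}}) : p != q -> p \notin L -> q \notin L ->
  #|F :&: (p |: (q |: L))| = ((p \in F) + (q \in F) + #|F :&: L|)%N.
Proof.
move=> pq pL qL.
have cnt A : #|F :&: A| = (\sum_(x in A) (x \in F))%N.
  rewrite -sum1_card big_mkcond [RHS]big_mkcond; apply: eq_bigr => x _.
  by rewrite inE; case: (x \in F); case: (x \in A).
have pqL : p \notin q |: L by rewrite in_setU1 negb_or pq.
by rewrite !cnt (big_setU1 _ pqL) (big_setU1 _ qL) /= addnA.
Qed.

(* Both pairs extend to a Latin square by the same set of [n - 2] permutations. *)
Lemma latin_trade (p q p' q' : {perm 'I_n}) : (forall i, p i <> q i) ->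
  (forall i, p' i = p i /\ q' i = q i \/ p' i = q i /\ q' i = p i) ->
  ((p \in F) + (q \in F) = (p' \in F) + (q' \in F))%N.
Proof.
move=> pq p'q'; pose o : 'I_n := Ordinal (leq_trans (isT : 0 < 8) n8).
have npq : p != q by apply/eqP => e; case: (pq o); rewrite e.
have p'q'i i : p' i <> q' i.
  by case: (p'q' i) => -[-> ->] e; [case: (pq i) | case: (pq i); rewrite e].
have np'q' : p' != q' by apply/eqP => e; case: (p'q'i o); rewrite e.
have [||L [sL dL cL]] := @latin_square_extends n [set p; q].
- apply/pairwise_disjointP => r t /set2P[->|->] /set2P[->|->] i // e.
    by case: (pq i).
  by case: (pq i); rewrite e.
- by rewrite cards2 npq; lia.
have pL : p \in L by apply: (subsetP sL); rewrite !inE eqxx.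
have qL : q \in L by apply: (subsetP sL); rewrite !inE eqxx orbT.
pose L0 := L :\ p :\ q.
have LE : p |: (q |: L0) = L by rewrite setD1K ?setD1K // !inE eq_sym npq.
have pL0 : p \notin L0 by rewrite !inE eqxx andbF.
have qL0 : q \notin L0 by rewrite !inE eqxx.
have dL' := pairwise_disjointP _ dL.
have L0p t i : t \in L0 -> t i <> p i /\ t i <> q i.
  rewrite !inE => /and3P[tq tp tL]; split=> e.
    by case/eqP: tp; apply: dL' e.
  by case/eqP: tq; apply: dL' e.
have L0p' t i : t \in L0 -> t i <> p' i /\ t i <> q' i.
  by move=> /(L0p t i) [tp tq]; case: (p'q' i) => -[-> ->].
have p'L0 : p' \notin L0 by apply/negP => /L0p'-/(_ o)[].
have q'L0 : q' \notin L0 by apply/negP => /L0p'-/(_ o)[].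
have c0 : (n = 2 + #|L0|)%N by rewrite -{1}cL -LE !cardsU1 in_setU1 negb_or npq pL0 qL0.
have := latinF dL cL; rewrite -{1}LE cardI_pair // => E1.
have := @latinF (p' |: (q' |: L0)).
rewrite cardI_pair // !cardsU1 in_setU1 negb_or np'q' p'L0 q'L0 /= => E2.
suff /E2 {}E2 : pairwise_disjoint (p' |: (q' |: L0)).
  by apply: (@addIn #|F :&: L0|); rewrite E1 (E2 (esym c0)).
apply/pairwise_disjointP => r t.
move=> /setU1P[->|/setU1P[->|rL]] /setU1P[->|/setU1P[->|tL]] i // e.
- by case: (p'q'i i).
- by case: (L0p' t i tL); rewrite e.
- by case: (p'q'i i).
- by case: (L0p' t i tL); rewrite e.
- by case: (L0p' r i rL).
- by case: (L0p' r i rL).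
- by case/setD1P: rL => _ /setD1P[_ rL]; case/setD1P: tL => _ /setD1P[_ tL]; apply: dL' e.
Qed.

Lemma latin_dictator :
  (exists x, forall p q : {perm 'I_n}, p x = q x -> (p \in F) = (q \in F)) \/
  (exists y, forall p q : {perm 'I_n}, p^-1 y = q^-1 y -> (p \in F) = (q \in F)).
Proof.
pose f (p : {perm 'I_n}) : int := Posz (p \in F).
have f01 p : f p = 0%R \/ f p = 1%R by rewrite /f; case: (p \in F); [right | left].
have [|w wE] := @swap_matrix n f n8.
  move=> p q p' q' H1 H2; have := latin_trade H1 H2; rewrite /f; clear; lia.
have [|[i di]|[u du]] := @matrix_dictator n w n8.
- move=> a b c e x y z t Ua Ux dab; apply/eqP/contraT => /eqP dce.
  have [//|s [sa sb sc se]] := perm_map_exists Ua Ux.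
  move: Ua; rewrite /= !inE !negb_or => /and4P[/and3P[ab ac ae] /andP[bc be] ce _].
  (* The swap at [a], [b] changes [f] by the same nonzero amount before and after the swap at [c],
     [e], which itself changes [f] by a nonzero amount. Four values in {0, 1} cannot do this. *)
  move: (wE s a b) (wE s c e) (wE (tperm c e * s) a b).
  rewrite !permM !tpermD 1?eq_sym // sa sb sc se.
  move: (f01 s) (f01 (tperm a b * s)) (f01 (tperm c e * s)) (f01 (tperm a b * (tperm c e * s))).
  move: dab dce; move: (f _) (f _) (f _) (f _) => f1 f2 f3 f4; clear; lia.
- left; exists i => p q pq.
  apply: (@tperm_connected _ _ [set i] (fun p => p \in F)) => [s a b|j]; last by rewrite inE => /eqP->.
  rewrite !inE => ai bi; have := wE s a b; rewrite (di a b ai bi (s a) (s b)) GRing.subrr => /GRing.subr0_eq[].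
  by case: (_ \in F); case: (_ \in F).
(* Connectivity is applied to the inverses, where swapping positions [a] and [b] of [s] amounts to
   swapping positions [s a] and [s b] of [s^-1]. The values exchanged there are [a] and [b], both
   different from [u]. *)
right; exists u => p q pq; rewrite -(invgK p) -(invgK q).
apply: (@tperm_connected _ _ [set u] (fun p => p^-1 \in F)) => [s a b|j]; last by rewrite inE => /eqP->.
rewrite !inE => au bu; rewrite invMg tpermV.
have -> : s^-1 * tperm a b = tperm (s a) (s b) * s^-1.
  by rewrite -tpermJ conjgE -!mulgA mulgV mulg1.
have := wE s^-1 (s a) (s b); rewrite !permK (du (s a) (s b) a b au bu) GRing.subrr => /GRing.subr0_eq[].
by case: (_ \in F); case: (_ \in F).
Qed.

End Equality.

(** * From a deciding row or column to the extremal families *)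

(** Take for [Y] the values at [x] of members of [F]. Evaluation at [x] is a bijection from a Latin
    square onto all indices and maps [F :&: L] onto [Y], so [Y] has [k] elements. *)
Lemma bigcup_Sig_row n k (F : {set {perm 'I_n}}) x : 0 < n ->
    (forall L : {set {perm 'I_n}}, pairwise_disjoint L -> #|L| = n -> #|F :&: L| = k) ->
    (forall p q : {perm 'I_n}, p x = q x -> (p \in F) = (q \in F)) ->
  exists Y : {set 'I_n}, #|Y| = k /\ F = \bigcup_(y in Y) Sig x y.
Proof.
move=> n0 latinF dict; pose ev (p : {perm 'I_n}) := p x.
exists (ev @: F); split; last first.
  apply/setP => p; apply/idP/bigcupP => [pF|[_ /imsetP[q qF ->]]].
    by exists (ev p); rewrite ?imset_f // inE.
  by rewrite inE => /eqP/dict->.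
have [||L [_ dL cL]] := @latin_square_extends n set0.
- by apply/pairwise_disjointP => p q; rewrite inE.
- by rewrite cards0.
have dL' := pairwise_disjointP _ dL.
have evL : ev @: L = setT.
  apply/eqP; rewrite eqEcard subsetT cardsT card_ord card_in_imset ?cL ?leqnn //.
  by move=> p q pL qL; apply: dL'.
rewrite -(latinF L dL cL) -(@card_in_imset _ _ ev (F :&: L)).
  congr #|pred_of_set _|; apply/setP => y; apply/imsetP/imsetP => -[p].
    move=> pF ->; have : ev p \in ev @: L by rewrite evL inE.
    case/imsetP=> q qL e; exists q => //; rewrite inE qL andbT.
    by rewrite -(dict p q e).
  by rewrite inE => /andP[pF _] ->; exists p.
by move=> p q; rewrite !inE => /andP[_ pL] /andP[_ qL]; apply: dL'.
Qed.

(** Inversion preserves Latin squares and exchanges positions with values, so the row version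
    applies to [F^-1]. *)
Lemma bigcup_Sig_col n k (F : {set {perm 'I_n}}) y : 0 < n ->
    (forall L : {set {perm 'I_n}}, pairwise_disjoint L -> #|L| = n -> #|F :&: L| = k) ->
    (forall p q : {perm 'I_n}, p^-1 y = q^-1 y -> (p \in F) = (q \in F)) ->
  exists X : {set 'I_n}, #|X| = k /\ F = \bigcup_(x in X) Sig x y.
Proof.
have invE (G : {set {perm 'I_n}}) p : (p \in G^-1) = (p^-1 \in G) by rewrite inE.
have pdV (L : {set {perm 'I_n}}) : pairwise_disjoint L -> pairwise_disjoint L^-1.
  move=> /pairwise_disjointP dL; apply/pairwise_disjointP => p q.
  rewrite !invE => pL qL i e; apply: invg_inj.
  by apply: (dL _ _ pL qL (p i)); rewrite permK e permK.
move=> n0 latinF dict; have [||X [cX EX]] := @bigcup_Sig_row n k F^-1 y n0.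
- move=> L dL cL; rewrite -(latinF (L^-1) (pdV _ dL)) ?card_invg //.
  by rewrite -[in RHS]card_invg invIg invgK.
- by move=> p q e; rewrite !invE; apply: dict; rewrite !invgK.
exists X; split=> //; apply/setP => p.
have -> : (p \in F) = (p^-1 \in F^-1) by rewrite invE invgK.
rewrite EX; apply/bigcupP/bigcupP => -[x xX]; rewrite inE => /eqP e; exists x => //.
  by rewrite inE -e permKV.
by rewrite inE -e permK.
Qed.

Close Scope group_scope.

Theorem theorem4 (n s : nat) (F : {set {perm 'I_n}}) :
  2 <= n -> 2 <= s -> s_bound n s -> nu F < s ->
  #|F| <= (s - 1) * (n - 1)`! /\
  (#|F| = (s - 1) * (n - 1)`! ->
     (exists (x : 'I_n) (Y : {set 'I_n}),
        #|Y| = s - 1 /\ F = \bigcup_(y in Y) Sig x y) \/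
     (exists (y : 'I_n) (X : {set 'I_n}),
        #|X| = s - 1 /\ F = \bigcup_(x in X) Sig x y)).
Proof.
move=> n2 s2 sb nuF; have n8 := s_bound_ge8 n2 s2 sb.
have n0 : 0 < n by exact: leq_trans n8.
split; first exact: card_nu_bound.
move=> cF; have latinF L := @card_latin_square_eq n F L s n0 nuF cF.
have [[x dx]|[y dy]] := latin_dictator n8 latinF.
- by left; exists x; apply: bigcup_Sig_row n0 latinF dx.
- by right; exists y; apply: bigcup_Sig_col n0 latinF dy.
Qed.
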